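(* Let $0<\alpha<\pi/6$, let $T$ be the Feres Random Map on $[0,\pi]$ with parameter $\alpha$, let $\mu(A)=\frac12\int_A\sin\theta\,d\theta$ for Borel $A\subset[0,\pi]$, and let $\nu$ be a probability measure on the Borel sets of $[0,\pi]$ with $\nu\ll\mu$. If $\frac{\alpha}{\pi}$ is a rational number, then the Strong Knudsen's Law does not hold, i.e. $\nu^{(n)}\not\to\mu$.
   Context: Feres Random Map. Fix $0<\alpha<\pi/6$. Put $T_1(\theta)=\theta+2\alpha$, $T_2(\theta)=-\theta+2\pi-4\alpha$, $T_3(\theta)=\theta-2\alpha$, $T_4(\theta)=-\theta+4\alpha$, and $u_a(\theta)=\frac12\left(1+\frac{\tan a}{\tan\theta}\right)$ (with $1/\tan(\pi/2)=0$). Define functions $p_i:[0,\pi]\to[0,1]$ by: $p_1(\theta)=1$ on $[0,\alpha)$, $u_\alpha(\theta)$ on $[\alpha,\pi-3\alpha)$, $2\cos(2\alpha)u_{2\alpha}(\theta)$ on $[\pi-3\alpha,\pi-2\alpha)$, $0$ on $[\pi-2\alpha,\pi]$; $p_2(\theta)=0$ on $[0,\pi-3\alpha)$, $u_\alpha(\theta)-2\cos(2\alpha)u_{2\alpha}(\theta)$ on $[\pi-3\alpha,\pi-2\alpha)$, $u_\alpha(\theta)$ on $[\pi-2\alpha,\pi-\alpha)$, $0$ on $[\pi-\alpha,\pi]$; $p_3(\theta)=0$ on $[0,2\alpha)$, $2\cos(2\alpha)u_{2\alpha}(-\theta)$ on $[2\alpha,3\alpha)$, $u_\alpha(-\theta)$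 on $[3\alpha,\pi-\alpha)$, $1$ on $[\pi-\alpha,\pi]$; $p_4(\theta)=0$ on $[0,\alpha)$, $u_\alpha(-\theta)$ on $[\alpha,2\alpha)$, $u_\alpha(-\theta)-2\cos(2\alpha)u_{2\alpha}(-\theta)$ on $[2\alpha,3\alpha)$, $0$ on $[3\alpha,\pi]$. The Feres Random Map $T$ sends $\theta$ to $T_i(\theta)$ with probability $p_i(\theta)$, $i=1,2,3,4$. Its transition kernel is $K(\theta,A)=\sum_{i=1}^4 p_i(\theta)\mathbf 1_A(T_i(\theta))$. Evolution of measures. For a Borel probability measure $\nu$ on $[0,\pi]$ set $\nu^{(0)}=\nu$ and $\nu^{(n+1)}(A)=\int_{[0,\pi]}K(\theta,A)\,d\nu^{(n)}(\theta)$ for $n\ge 0$. Strong Knudsen's Law. The convergence $\nu^{(n)}(A)\to\mu(A)$ for all Borel sets $A\subset[0,\pi]$ (where $\nu\ll\mu$) is called the Strong Knudsen's Law for the random map $T$.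
   Formalization: The claim fails for ν = μ, which is invariant (μ^(n) = μ), so the Strong Knudsen's Law is read as a property of T, quantified over all probability measures ν ≪ μ, and what is stated is that this law fails, i.e. ν^(n) does not converge to μ for some ν ≪ μ. *)

(* Defs.v *)
From HB Require Import structures.
From mathcomp Require Import all_boot all_order all_algebra.
From mathcomp Require Import all_classical all_reals all_analysis.

Set Implicit Arguments.
Unset Strict Implicit.
Unset Printing Implicit Defensive.

Import Order.TTheory GRing.Theory Num.Theory.
Import numFieldNormedType.Exports.

Local Open Scope classical_set_scope.
Local Open Scope ring_scope.

Section FeresRandomMap.
Context {R : realType}.
Implicit Types (a alpha theta : R) (A : set R).

Definition feres_T1 alpha theta : R := theta + 2 * alpha.
Definition feres_T2 alpha theta : R := - theta + 2 * pi - 4 * alpha.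
Definition feres_T3 alpha theta : R := theta - 2 * alpha.
Definition feres_T4 alpha theta : R := - theta + 4 * alpha.

(* The convention 1 / tan (pi / 2) = 0 holds here: cos (pi / 2) = 0 and
   x / 0 = 0, so tan (pi / 2) = 0 and tan a / tan (pi / 2) = 0. *)
Definition feres_u a theta : R := (1 + tan a / tan theta) / 2.

(* The four weights are meant on [0, pi]; the tests below read the intervals
   off from left to right, and the values outside [0, pi] are never used. *)
Definition feres_p1 alpha theta : R :=
  if theta < alpha then 1
  else if theta < pi - 3 * alpha then feres_u alpha theta
  else if theta < pi - 2 * alpha then
    2 * cos (2 * alpha) * feres_u (2 * alpha) theta
  else 0.

Definition feres_p2 alpha theta : R :=
  if theta < pi - 3 * alpha then 0
  else if theta < pi - 2 * alpha then
    feres_u alpha theta - 2 * cos (2 * alpha) * feres_u (2 * alpha) theta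
  else if theta < pi - alpha then feres_u alpha theta
  else 0.

Definition feres_p3 alpha theta : R :=
  if theta < 2 * alpha then 0
  else if theta < 3 * alpha then
    2 * cos (2 * alpha) * feres_u (2 * alpha) (- theta)
  else if theta < pi - alpha then feres_u alpha (- theta)
  else 1.

Definition feres_p4 alpha theta : R :=
  if theta < alpha then 0
  else if theta < 2 * alpha then feres_u alpha (- theta)
  else if theta < 3 * alpha then
    feres_u alpha (- theta)
    - 2 * cos (2 * alpha) * feres_u (2 * alpha) (- theta)
  else 0.

Definition feres_kernel alpha theta A : R :=
  feres_p1 alpha theta * \1_A (feres_T1 alpha theta)
  + feres_p2 alpha theta * \1_A (feres_T2 alpha theta)
  + feres_p3 alpha theta * \1_A (feres_T3 alpha theta)
  + feres_p4 alpha theta * \1_A (feres_T4 alpha theta).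

Fixpoint feres_evolution alpha (nu : set (measurableTypeR R) -> \bar R)
    (n : nat) : set (measurableTypeR R) -> \bar R :=
  if n is n'.+1 then
    fun A => (\int[feres_evolution alpha nu n']_(theta in `[0%R, pi])
                (feres_kernel alpha theta A)%:E)%E
  else nu.

(* A measure on [0, pi] is represented by a measure on the Borel sets of the
   line that is concentrated on [0, pi]; hence the intersection. *)
Definition knudsen_mu (A : set (measurableTypeR R)) : \bar R :=
  ((1 / 2)%:E *
   \int[lebesgue_measure]_(theta in A `&` `[0%R, pi]) (sin theta)%:E)%E.

Definition evolution_converges alpha
    (nu : set (measurableTypeR R) -> \bar R) : Prop :=
  forall A : set (measurableTypeR R), measurable A -> A `<=` `[0, pi] ->
    feres_evolution alpha nu n A @[n --> \oo] --> knudsen_mu A.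

(* The law is a property of the random map, so the initial distribution is
   universally quantified: started from nu = mu, which is invariant, the
   evolution converges whatever alpha is. *)
Definition strong_knudsen_law alpha : Prop :=
  forall nu : probability (measurableTypeR R) R,
    nu `[0%R, pi]%classic = 1%E -> nu `<< knudsen_mu -> evolution_converges alpha nu.

End FeresRandomMap.

(* Main.v *)
(** If [alpha * b = n * pi], then [x |-> cos (b * x)] is invariant under each of
the four branches of the random map, so mass never enters
[F = {x | cos (b * x) <= 0}] from outside.  The uniform law on an interval where
[cos (b * x)] is positive therefore gives mass [0] to [F] at every time, whereas
the limit [mu] charges an interval contained in [F]. *)
Require Import Defs.
From mathcomp Require Import all_boot all_order all_algebra.
From mathcomp Require Import all_classical all_reals all_analysis.
From mathcomp Require Import measurable_realfun lra ring.
Import Order.TTheory GRing.Theory Num.Theory.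
Local Open Scope ring_scope.

Import HBNNSimple.

(* [mu] is a bare set function in the two lemmas below because
   [feres_evolution] is not packaged as a measure. *)
Lemma sintegral_null_set d (T : measurableType d) (R : realType)
    (mu : set T -> \bar R) (F : set T) (h : {nnsfun T >-> R}) :
  mu.-null_set F -> (forall x, ~ F x -> h x = 0) -> sintegral mu h = 0%E.
Proof.
move=> F0 h0; rewrite /sintegral fsbig1// => r _.
have [->|r0] := eqVneq r 0; first by rewrite mul0e.
rewrite [mu _]F0 ?mule0// => x /= hxr.
by apply: contrapT => /h0; rewrite hxr; exact/eqP.
Qed.

Lemma integral_null_set d (T : measurableType d) (R : realType)
    (mu : set T -> \bar R) (F D : set T) (f : T -> \bar R) :
  mu.-null_set F -> (forall x, ~ F x -> f x = 0%E) ->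
  (\int[mu]_(x in D) f x = 0)%E.
Proof.
move=> F0 f0; rewrite /integral /=.
(* The integral is a difference of two suprema, over simple functions below the positive and the
   negative part. Such functions vanish off [F], so each supremum is that of the singleton of 0;
   [nnsfun0] shows that the set is inhabited. *)
have sup0 (g : T -> \bar R) : (forall x, ~ F x -> g x = 0%E) ->
    (forall x, 0 <= g x)%E ->
    ereal_sup [set sintegral mu h | h in
      [set h : {nnsfun T >-> R} | forall x, ((h x)%:E <= g x)%E]]%classic = 0%E.
  move=> gF g0; rewrite (_ : (_ @` _)%classic = [set 0%E]%classic) ?ereal_sup1//.
  apply/seteqP; split=> [_ [h /= hg <-]|_ ->].
    apply: (sintegral_null_set _ _ _ _ F) => // x /gF gx0.
    by apply/eqP; rewrite eq_le fun_ge0 andbT -lee_fin (le_trans (hg x))// gx0.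
  by exists nnsfun0 => //; exact: (sintegral_null_set _ _ _ _ F).
have fD0 x : ~ F x -> (patch (cst 0%E) D f) x = 0%E.
  by move=> /f0 fx0; rewrite patchE fx0; case: ifP.
rewrite !sup0 ?sube0// => x /fD0; rewrite ?funeposE ?funenegE => ->.
  by rewrite oppe0 maxxx.
by rewrite maxxx.
Qed.

Section Feres.
Variables (R : realType) (alpha : R).

(** The first hypothesis is backward invariance: no branch leads from outside [F] into [F], so all
    four indicators of [A] vanish. *)
Lemma feres_kernel_eq0 (F A : set R) (theta : R) :
  (forall x, F (feres_T1 alpha x) \/ F (feres_T2 alpha x) \/
             F (feres_T3 alpha x) \/ F (feres_T4 alpha x) -> F x) ->
  (A `<=` F)%classic -> ~ F theta -> feres_kernel alpha theta A = 0.
Proof.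
move=> FT AF nF; rewrite /feres_kernel !indicE.
do 4 (rewrite memNset ?mulr0; last by move=> /AF ?; apply/nF/FT; tauto).
by rewrite !addr0.
Qed.

(** Induction on time: the kernel vanishes off [F], and [F] is null for the measure integrated
    against. *)
Lemma feres_evolution_null_set (nu : set (measurableTypeR R) -> \bar R)
    (F : set (measurableTypeR R)) (n : nat) :
  (forall x, F (feres_T1 alpha x) \/ F (feres_T2 alpha x) \/
             F (feres_T3 alpha x) \/ F (feres_T4 alpha x) -> F x) ->
  nu.-null_set F -> (feres_evolution alpha nu n).-null_set F.
Proof.
move=> FT F0; elim: n => [//|n IHn] A mA AF /=.
apply: (integral_null_set _ _ _ _ _ _ _ IHn) => x nFx.
by rewrite (feres_kernel_eq0 _ _ _ FT AF nFx).
Qed.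

(** After scaling by [b], each branch is [x] or [- x] shifted by multiples of [2 * pi], since
    [2 * alpha] becomes [2 * n * pi]; cosine is even and periodic. *)
Lemma cos_feres_T (n b : nat) (x : R) : alpha * b%:R = n%:R * pi ->
  [/\ cos (b%:R * feres_T1 alpha x) = cos (b%:R * x),
      cos (b%:R * feres_T2 alpha x) = cos (b%:R * x),
      cos (b%:R * feres_T3 alpha x) = cos (b%:R * x) &
      cos (b%:R * feres_T4 alpha x) = cos (b%:R * x)].
Proof.
move=> ab.
have cosD m (y : R) : cos (y + 2 * (m%:R * pi)) = cos y.
  rewrite -[RHS](periodicn (@cosD2pi R) m).
  by rewrite mulr_natl (mulr_natl pi) mulrnAC.
have cosB m (y : R) : cos (y - 2 * (m%:R * pi)) = cos y.
  by rewrite -(cosD m) subrK.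
rewrite /feres_T1 /feres_T2 /feres_T3 /feres_T4; split.
- by rewrite -[RHS](cosD n) -ab; congr cos; ring.
- rewrite -[RHS]cosN -[RHS](cosB n) -[RHS](cosB n) -[RHS](cosD b) -ab.
  by congr cos; ring.
- by rewrite -[RHS](cosB n) -ab; congr cos; ring.
- by rewrite -[RHS]cosN -[RHS](cosD n) -[RHS](cosD n) -ab; congr cos; ring.
Qed.

(** The density [sin] is positive on the open interval, so it can have zero integral only over a
    Lebesgue-null set. *)
Lemma knudsen_mu_eq0 (A : set (measurableTypeR R)) :
  measurable A -> (A `<=` `]0%R, pi[)%classic -> knudsen_mu A = 0%E ->
  lebesgue_measure A = 0%E.
Proof.
move=> mA A0pi /eqP; rewrite /knudsen_mu mule_eq0 eqe mul1r invr_eq0.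
rewrite pnatr_eq0/= setIidl; last first.
  by apply: (subset_trans A0pi); exact: subset_itv_oo_cc.
move=> /eqP sinA0.
have A_gt0 x : A x -> 0 < sin x.
  by move=> /A0pi /=; rewrite in_itv/= => ?; exact: sin_gt0_pi.
have msin : measurable_fun A (fun x : R => (sin x)%:E).
  apply/measurable_EFinP; apply: measurable_funTS.
  by apply: continuous_measurable_fun; exact: continuous_sin.
have := (ae_eq_integral_abs lebesgue_measure mA msin).1.
rewrite -[X in X = _ -> _](_ : \int[lebesgue_measure]_(x in A) (sin x)%:E = _)%E; last first.
  apply: eq_integral => x /set_mem /A_gt0 sx.
  by rewrite gee0_abs// lee_fin ltW.
move=> /(_ sinA0) A0; apply: measure_negligible => //.
(* As [sin] has no zero in [A], all of [A] lies in the exceptional set of the almost everywhere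
   equality. *)
apply: negligibleS A0 => x Ax /= /(_ Ax) [sx0].
by have := A_gt0 _ Ax; rewrite sx0 ltxx.
Qed.

(** The uniform law sees only the part of a set inside [[a, b]], which avoids the zeros of [sin] at
    0 and [pi]. *)
Lemma uniform_prob_dominated (a b : R) (ab : a < b) : 0 < a -> b < pi ->
  uniform_prob ab `<< @knudsen_mu R.
Proof.
move=> a0 bpi N N0 A mA AN.
rewrite /uniform_prob integral_uniform_pdf.
have mAab : measurable (A `&` `[a, b] : set (measurableTypeR R))%classic.
  exact: measurableI.
have /null_content_dominatesP/(_ _ mAab) := dominates_uniform_prob ab.
apply; apply: knudsen_mu_eq0 => //.
  move=> x [_] /=; rewrite !in_itv/= => /andP[ax xb].
  by rewrite (lt_le_trans a0 ax) (le_lt_trans xb bpi).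
by apply: N0 => // x [Ax _]; exact: AN.
Qed.

End Feres.

Theorem proposition3p10 (R : realType) (alpha : R)
  (alpha_gt0 : 0 < alpha) (alpha_lt : alpha < pi / 6)
  (alpha_rational : rational (alpha / pi)) :
  ~ strong_knudsen_law alpha.
Proof.
have pi0 := pi_gt0 R.
have [n [b [b0 ab]]] : exists n b : nat, (0 < b)%N /\ alpha * b%:R = n%:R * pi.
  have api : 0 < alpha / pi by rewrite divr_gt0.
  move/rationalP : alpha_rational => [a [b ab]]; move: api; rewrite ab.
  (* A zero denominator would make the quotient 0 by convention, against [api]; positivity then also
     excludes a negative numerator. *)
  case: b ab => [|b] ab; first by rewrite invr0 mulr0 ltxx.
  rewrite pmulr_lgt0 ?invr_gt0 ?ltr0n// ltr0z.
  case: a ab => [n|//] ab _; exists n, b.+1; split => //.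
  by rewrite -[alpha](@divfK _ pi) ?gt_eqF// ab mulrAC divfK.
have bR : 0 < b%:R :> R by rewrite ltr0n.
have bR1 : 1 <= b%:R :> R by rewrite ler1n.
(* For [x] in [[c, 2 * c]], [b * x] runs over [[pi/8, pi/4]], where cosine is positive; for [x] in
   [[4 * c, 6 * c]], over [[pi/2, 3 * pi/4]], where it is at most 0. As [b >= 1], both intervals lie
   inside []0, pi[]. *)
pose c : R := pi / (8 * b%:R).
have c0 : 0 < c by rewrite divr_gt0// mulr_gt0.
have bc : b%:R * c = pi / 8 by rewrite /c; field; rewrite gt_eqF.
have cpi : c <= pi / 8 by rewrite -bc ler_peMl// ltW.
pose F : set (measurableTypeR R) := [set x | cos (b%:R * x) <= 0]%classic.
have FT x : F (feres_T1 alpha x) \/ F (feres_T2 alpha x) \/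
             F (feres_T3 alpha x) \/ F (feres_T4 alpha x) -> F x.
  have [t1 t2 t3 t4] := cos_feres_T R alpha n b x ab.
  by rewrite /F/= t1 t2 t3 t4; tauto.
have c12 : c < 2 * c by lra.
pose nu : probability (measurableTypeR R) R := uniform_prob c12.
have nuF : nu.-null_set F.
  move=> A mA AF; rewrite /nu /= /uniform_prob integral_uniform_pdf.
  rewrite [X in (\int[_]_(_ in X) _)%E](_ : _ = set0) ?integral_set0//.
  rewrite -subset0 => x [/AF]; rewrite /F/= leNgt => /negP Fx.
  rewrite in_itv/= => /andP[cx xc]; apply: Fx; apply: cos_gt0_pihalf.
  have : b%:R * c <= b%:R * x by rewrite ler_pM2l.
  have : b%:R * x <= b%:R * (2 * c) by rewrite ler_pM2l.
  by rewrite mulrCA bc => *; apply/andP; split; lra.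
move=> /(_ nu) law.
have {law} /(_ (`[4 * c, 6 * c])%classic) law : evolution_converges alpha nu.
  apply: law.
    rewrite /nu/=; apply: integral_uniform_pdf1 => // x /=.
    rewrite !in_itv/= => /andP[cx xc]; apply/andP; split; lra.
  by apply: uniform_prob_dominated => //; lra.
set A := (`[4 * c, 6 * c])%classic in law.
have AF : (A `<=` F)%classic.
  move=> x; rewrite /A /F /= in_itv/= => /andP[cx xc].
  (* Shifting by [pi] flips the sign and brings the angle into [[-pi/2, -pi/4]]. *)
  rewrite -[_ * x](subrK pi) cosDpi oppr_le0 cos_ge0_pihalf//.
  have : b%:R * (4 * c) <= b%:R * x by rewrite ler_pM2l.
  have : b%:R * x <= b%:R * (6 * c) by rewrite ler_pM2l.
  by rewrite ![b%:R * (_ * c)]mulrCA bc => *; apply/andP; split; lra.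
have mA : measurable (A : set (measurableTypeR R)) by exact: measurable_itv.
(* The evolution gives [A] mass 0 at every time, so uniqueness of limits forces this value; it
   contradicts the length [2 * c > 0] of [A]. *)
have A0 : knudsen_mu A = 0%E.
  have /law {}law : (A `<=` `[0, pi])%classic.
    move=> x; rewrite /A /= !in_itv/= => /andP[cx xc]; apply/andP; split; lra.
  apply: (cvg_unique _ (law mA)) => //.
  rewrite (_ : (fun n => _) = cst 0%E); first exact: cvg_cst.
  by apply/funext => m; apply: (feres_evolution_null_set _ _ _ F).
have : lebesgue_measure (A : set (measurableTypeR R)) = 0%E.
  apply: knudsen_mu_eq0 => // x; rewrite /A/= !in_itv/= => /andP[cx xc].
  by apply/andP; split; lra.
rewrite /A lebesgue_measure_itv/= lte_fin ifT; last by lra.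
by rewrite -EFinD => -[]; lra.
Qed.
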